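(* Let $n$ be a positive integer. (i) For every $\varepsilon$ with $0<\varepsilon<1$, the generalized BS protocol, applied to two copies of the correlated non-local box $P^{\mathrm{PR}}_{n,\varepsilon}$, simulates exactly an $n$-partite correlated non-local box $P^{\mathrm{PR}}_{n,\varepsilon'}$ for some $\varepsilon'$ with $\varepsilon'>\varepsilon$; in particular $(P^{\mathrm{PR}}_{n,\varepsilon})^{\otimes 2}\succeq P^{\mathrm{PR}}_{n,\varepsilon'}$. (ii) For every $\varepsilon>0$ (with $\varepsilon\le 1$), in the asymptotic limit of many copies, the (iterated) generalized BS protocol distills $P^{\mathrm{PR}}_{n,\varepsilon}$ to a box arbitrarily close to the $n$-PR box $P^{\mathrm{PR}}_n$: the boxes obtained by iterating the protocol on $2^m$ copies of $P^{\mathrm{PR}}_{n,\varepsilon}$ converge to $P^{\mathrm{PR}}_n$ as $m\to\infty$. In particular $P^{\mathrm{PR}}_{n,\varepsilon}\rightarrow^* P^{\mathrm{PR}}_n$.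
   Context: All inputs and outputs are bits. An $n$-partite box is a conditional distribution $P(a_1\cdots a_n\mid x_1\cdots x_n)$, where party $i$ has input $x_i\in\{0,1\}$ and output $a_i\in\{0,1\}$, that is non-signaling (the marginal distribution of the outputs of any subset of parties depends only on the inputs of that subset). The $n$-PR box is $P^{\mathrm{PR}}_n(a\mid x)=2^{-(n-1)}$ if $\bigoplus_i a_i=\prod_i x_i$, and $0$ otherwise. The even-parity box is $P^{\mathrm c}_n(a\mid x)=2^{-(n-1)}$ if $\bigoplus_i a_i=0$, and $0$ otherwise. The correlated non-local boxes are $P^{\mathrm{PR}}_{n,\varepsilon}=\varepsilon P^{\mathrm{PR}}_n+(1-\varepsilon)P^{\mathrm c}_n$, $0\le\varepsilon\le 1$. Generalized BS protocol: the $n$ parties share two independent boxes. On input $x_i$, party $i$ inputs $x_i$ to the first box and receives $a_i$; then inputs $y_i=x_i\cdot(1\oplus a_i)$ to the second box and receives $b_i$; and finally outputs $c_i=a_i\oplus b_i$. The box simulated is the conditional distribution of $(c_1,\dots,c_n)$ given $(x_1,\dots,x_n)$. Iteration: starting with $2^m$ copies of a box, the protocol is applied to pairs to yield $2^{m-1}$ copies of a new box, then again to pairs of these, and so on for $m$ rounds, yielding one final box. $R\succeq R'$ means that there is a protocol without communication, using local operations on the resource $R$ (each party may choose its inputs to the shared systems adaptively, depending on its own input, shared randomness and outputs it already received) and shared randomness, whose conditional output distribution is exactly $R'$. $R^{\otimes k}$ denotes $k$ independent copies of $R$. $R\rightarrow^* R'$ means that for every $\delta>0$ there are a finite $k$ and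 such a protocol using $k$ copies of $R$ whose conditional output distribution is within $\delta$ of $R'$. *)

(* Defs.v *)
From HB Require Import structures.
From mathcomp Require Import all_boot all_order all_algebra.
From mathcomp Require Import all_classical all_reals all_analysis.
Set Implicit Arguments.
Unset Strict Implicit.
Unset Printing Implicit Defensive.
Import Order.TTheory GRing.Theory Num.Theory numFieldNormedType.Exports.
Local Open Scope ring_scope.

Notation bits n := {ffun 'I_n -> bool}.

Definition agree_on n (S : {set 'I_n}) (a b : bits n) : bool :=
  [forall i in S, a i == b i].

(* [P a x] is P(a_1 .. a_n | x_1 .. x_n). *)
Record box (R : realType) (n : nat) := Box {
  box_prob :> bits n -> bits n -> R;
  box_ge0 : forall a x, 0 <= box_prob a x;
  box_sum1 : forall x, \sum_a box_prob a x = 1;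
  box_nonsignaling : forall (S : {set 'I_n}) (a x x' : bits n),
    agree_on S x x' ->
    \sum_(a' | agree_on S a' a) box_prob a' x =
    \sum_(a' | agree_on S a' a) box_prob a' x' }.

Definition parity n (a : bits n) : bool := \big[addb/false]_i a i.

Definition pr_prob (R : realType) n (a x : bits n) : R :=
  if parity a == \big[andb/true]_i x i then 2 ^- n.-1 else 0.

Definition even_prob (R : realType) n (a x : bits n) : R :=
  if parity a == false then 2 ^- n.-1 else 0.

Section ParityBoxes.
Variables (R : realType) (n : nat).
Implicit Types (a x : bits n) (S : {set 'I_n}).

Let flip (i : 'I_n) (a : bits n) : bits n := [ffun j => (j == i) (+) a j].

Lemma flipK i : involutive (flip i).
Proof. by move=> a; apply/ffunP => j; rewrite !ffunE addbA addbb. Qed.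

Lemma parity_flip i a : parity (flip i a) = ~~ parity a.
Proof.
rewrite /parity (bigD1 i) //= [in RHS](bigD1 i) //= ffunE eqxx /= addNb.
congr (~~ (_ (+) _)); apply: eq_bigr => j /negbTE ji.
by rewrite ffunE ji.
Qed.

Lemma sum_parity_flip S i a b (w : R) : i \notin S ->
  \sum_(a' | agree_on S a' a) (if parity a' == b then w else 0) =
  \sum_(a' | agree_on S a' a) (if parity a' == ~~ b then w else 0).
Proof.
move=> iS; rewrite (reindex_inj (inv_inj (flipK i))) /=.
apply: eq_big => [a'|a' _]; last first.
  by rewrite parity_flip; case: (parity a'); case: b.
apply/eq_forallb => j; rewrite ffunE; case: (eqVneq j i) => [->|//].
by rewrite (negbTE iS).
Qed.

Lemma parity_prob_nonsignaling (g : bits n -> bool) (w : R) S a x x' :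
  agree_on S x x' ->
  \sum_(a' | agree_on S a' a) (if parity a' == g x then w else 0) =
  \sum_(a' | agree_on S a' a) (if parity a' == g x' then w else 0).
Proof.
move=> xx'; case: (boolP [forall i, i \in S]) => [/forallP ST|].
  suff -> : x = x' by [].
  by apply/ffunP => i; apply/eqP; move/forallP: xx' => /(_ i)/implyP; apply.
rewrite negb_forall => /existsP[i iS].
have [<-//|gN] := eqVneq (g x) (g x').
rewrite (sum_parity_flip _ _ _ iS); apply: eq_bigr => a' _.
by move: gN; case: (g x); case: (g x').
Qed.

Lemma parity_prob_sum1 (b : bool) : (0 < n)%N ->
  \sum_(a : bits n) (if parity a == b then 2 ^- n.-1 else 0 : R) = 1.
Proof.
move=> n_gt0; pose i := Ordinal n_gt0.
pose w : R := 2 ^- n.-1; pose s b' := \sum_(a : bits n) (if parity a == b' then w else 0).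
have s0 b' : s b' = s (~~ b').
  have := @sum_parity_flip finset.set0 i [ffun=> false] b' w.
  rewrite inE => /(_ isT).
  have ag a : agree_on finset.set0 a [ffun=> false].
    by apply/forallP => j; rewrite inE.
  by rewrite /s !(eq_bigl _ _ ag).
have : s b + s (~~ b) = 2.
  rewrite /s -big_split /= (eq_bigr (fun=> w)); last first.
    by move=> a _; case: (parity a); case: b; rewrite /= ?addr0 ?add0r.
  rewrite sumr_const card_ffun card_bool card_ord -[w *+ _]mulr_natr natrX.
  have -> : 2 ^+ n = 2 * 2 ^+ n.-1 :> R by rewrite -exprS prednK.
  by rewrite /w mulrCA mulVf ?mulr1 // expf_neq0.
rewrite -s0 -mulr2n -[X in _ = X](mulr1 2) mulr_natl => /eqP.
by rewrite eqrMn2r // => /eqP.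
Qed.

Lemma parity_prob_ge0 (b : bool) a :
  0 <= (if parity a == b then 2 ^- n.-1 else 0 : R).
Proof. by case: ifP => // _; rewrite invr_ge0 exprn_ge0. Qed.

End ParityBoxes.

Definition pr_box (R : realType) n (n_gt0 : (0 < n)%N) : box R n :=
  @Box R n (@pr_prob R n)
    (fun a x => parity_prob_ge0 R _ a)
    (fun x => parity_prob_sum1 R _ n_gt0)
    (parity_prob_nonsignaling (fun x : bits n => \big[andb/true]_i x i) _).

Definition even_box (R : realType) n (n_gt0 : (0 < n)%N) : box R n :=
  @Box R n (@even_prob R n)
    (fun a x => parity_prob_ge0 R _ a)
    (fun x => parity_prob_sum1 R _ n_gt0)
    (parity_prob_nonsignaling (fun x : bits n => false) _).

Section CorrelatedBox.
Variables (R : realType) (n : nat) (n_gt0 : (0 < n)%N) (e : {i01 R}).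

Definition cnl_prob (a x : bits n) : R :=
  e%:num * pr_box R n_gt0 a x + (1 - e%:num) * even_box R n_gt0 a x.

Lemma cnl_prob_ge0 a x : 0 <= cnl_prob a x.
Proof.
by rewrite addr_ge0 // mulr_ge0 ?box_ge0 // subr_ge0.
Qed.

Lemma cnl_prob_sum1 x : \sum_a cnl_prob a x = 1.
Proof.
rewrite big_split -!mulr_sumr (box_sum1 (pr_box R n_gt0)).
by rewrite (box_sum1 (even_box R n_gt0)) !mulr1 /= addrC subrK. Qed.

Lemma cnl_prob_nonsignaling (S : {set 'I_n}) a x x' : agree_on S x x' ->
  \sum_(a' | agree_on S a' a) cnl_prob a' x =
  \sum_(a' | agree_on S a' a) cnl_prob a' x'.
Proof.
move=> xx'; rewrite !big_split -!mulr_sumr (box_nonsignaling (pr_box R n_gt0) _ xx').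
by rewrite (box_nonsignaling (even_box R n_gt0) _ xx').
Qed.

Definition cnl_box : box R n :=
  Box cnl_prob_ge0 cnl_prob_sum1 cnl_prob_nonsignaling.

End CorrelatedBox.

(* What one party does with its shares of k boxes once its own input and the
   shared randomness are fixed: [Query j y next] inputs y to box j and goes on
   with [next b] on receiving b; [Output c] stops and outputs c.  The boxes may
   be used in any, adaptively chosen, order. *)
Inductive strategy (k : nat) :=
| Output of bool
| Query of 'I_k & bool & (bool -> strategy k).

(* The input made to box j when the boxes answer o.  Only the first query of a
   box counts: querying it again just recalls its answer.  A box that is never
   queried is given the input 0, which by non-signaling does not affect the
   other parties. *)
Fixpoint query_input k (s : strategy k) (o : 'I_k -> bool) (j : 'I_k) : bool :=
  match s with
  | Output _ => false
  | Query j0 y next =>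
      if j == j0 then y else query_input (next (o j0)) o j
  end.

Fixpoint final_output k (s : strategy k) (o : 'I_k -> bool) : bool :=
  match s with
  | Output c => c
  | Query j0 _ next => final_output (next (o j0)) o
  end.

(* Shared randomness is a finite random variable; as a party has only finitely
   many deterministic behaviours on k boxes, this is no restriction, and it
   subsumes local randomness. *)
Record protocol (R : realType) (n k : nat) := Protocol {
  randomness : finType;
  rand_prob : randomness -> R;
  rand_prob_ge0 : forall l, 0 <= rand_prob l;
  rand_prob_sum1 : \sum_l rand_prob l = 1;
  local_strategy : randomness -> 'I_n -> bool -> strategy k }.

Section Run.
Variables (R : realType) (n k : nat).
Implicit Types (B : 'I_k -> box R n) (s : 'I_n -> strategy k).
Implicit Types (pi : protocol R n k) (c x : bits n) (S : {set 'I_n}).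

Definition box_inputs s (a : {ffun 'I_k -> bits n}) (j : 'I_k) : bits n :=
  [ffun i => query_input (s i) (fun j' => a j' i) j].

Definition final_outputs s (a : {ffun 'I_k -> bits n}) : bits n :=
  [ffun i => final_output (s i) (fun j => a j i)].

(* The probability that independent boxes B_1 .. B_k output a_1 .. a_k when the
   inputs are chosen by s is the product over j of B_j(a_j | inputs of box j). *)
Definition wiring_prob B s c : R :=
  \sum_(a : {ffun 'I_k -> bits n} | final_outputs s a == c)
    \prod_j B j (a j) (box_inputs s a j).

Definition run_prob pi B c x : R :=
  \sum_(l : randomness pi)
    rand_prob l * wiring_prob B (fun i => local_strategy l i (x i)) c.

Let marg B s S c : R :=
  \sum_(a : {ffun 'I_k -> bits n} | agree_on S (final_outputs s a) c)
    \prod_j B j (a j) (box_inputs s a j).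

Lemma eq_query_input (s : strategy k) o o' j :
  o =1 o' -> query_input s o j = query_input s o' j.
Proof.
move=> oo'; elim: s => [//|j0 y next IH] /=.
by rewrite oo' IH.
Qed.

Lemma eq_final_output (s : strategy k) o o' :
  o =1 o' -> final_output s o = final_output s o'.
Proof.
move=> oo'; elim: s => [//|j0 y next IH] /=.
by rewrite oo' IH.
Qed.

Lemma sum_strategy (s : strategy k) (f : 'I_k -> bool -> bool -> R) :
  (forall j y, \sum_b f j b y = \sum_b f j b false) ->
  \sum_(o : {ffun 'I_k -> bool}) \prod_j f j (o j) (query_input s o j) =
  \prod_j \sum_b f j b false.
Proof.
elim: s f => [c|j0 y next IH] f fP /=.
  by rewrite bigA_distr_bigA.
rewrite (partition_big (fun o : {ffun 'I_k -> bool} => o j0) predT) //=.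
pose f' b j b' y' := if j == j0 then (if b' == b then f j0 b y else 0)
                     else f j b' y'.
have f'P b j y' : \sum_b' f' b j b' y' = \sum_b' f' b j b' false.
  by rewrite /f'; case: eqP => // _; rewrite fP.
rewrite (eq_bigr (fun b => \prod_j \sum_b' f' b j b' false)); last first.
  move=> b _; rewrite -(IH b (f' b) (f'P b)).
  rewrite [RHS](bigID (fun o : {ffun 'I_k -> bool} => o j0 == b)) /=.
  rewrite [X in _ = _ + X]big1 ?addr0; last first.
    move=> o /negbTE ob; rewrite (bigD1 j0) //= {1}/f' eqxx ob mul0r //.
  apply: eq_bigr => o /eqP ob; rewrite (bigD1 j0) //= [RHS](bigD1 j0) //=.
  rewrite eqxx {1}/f' eqxx ob eqxx; congr (_ * _).
  by apply: eq_bigr => j /negbTE jj0; rewrite /f' jj0.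
rewrite [RHS](bigD1 j0) //= -(fP j0 y) mulr_suml; apply: eq_bigr => b _.
rewrite (bigD1 j0) //=; congr (_ * _).
  by rewrite /f' eqxx -big_mkcond /= big_pred1_eq.
apply: eq_bigr => j /negbTE jj0; rewrite /f' jj0.
by apply: eq_bigr.
Qed.

Let upd (i0 : 'I_n) (x : bits n) (b : bool) : bits n :=
  [ffun i => if i == i0 then b else x i].

Lemma marg_local B s s' S c (i0 : 'I_n) :
  i0 \notin S -> (forall i, i != i0 -> s i = s' i) ->
  marg B s S c = marg B s' S c.
Proof.
move=> i0S ss'.
pose key (a : {ffun 'I_k -> bits n}) := [ffun j => upd i0 (a j) false].
pose glue (r : {ffun 'I_k -> bits n}) (o : {ffun 'I_k -> bool}) :=
  [ffun j => upd i0 (r j) (o j)] : {ffun 'I_k -> bits n}.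
pose z t (r : {ffun 'I_k -> bits n}) j : bits n := box_inputs t r j.
have margE t : marg B t S c =
    \sum_(r | (key r == r) && agree_on S (final_outputs t r) c)
      \prod_j \sum_b B j (upd i0 (r j) b) (upd i0 (z t r j) false).
  have keyin r i j : i != i0 -> key r j i = r j i.
    by move=> /negbTE ii0; rewrite !ffunE ii0.
  have agE (r r' : {ffun 'I_k -> bits n}) :
      (forall i j, i != i0 -> r j i = r' j i) ->
      agree_on S (final_outputs t r) c = agree_on S (final_outputs t r') c.
    move=> rr'; apply: eq_forallb => i; case: (boolP (i \in S)) => //= iS.
    rewrite !ffunE; congr (_ == _); apply: eq_final_output => j.
    by apply: rr'; apply: contraNneq i0S => <-.
  rewrite /marg (partition_big key
    (fun r => (key r == r) && agree_on S (final_outputs t r) c)) /=; last first.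
    move=> a aS; rewrite (agE _ a) ?aS ?andbT; last by move=> i j; apply: keyin.
    apply/eqP/ffunP => j; apply/ffunP => i; rewrite !ffunE.
    by case: eqP.
  apply: eq_bigr => r /andP[/eqP rK rS].
  rewrite (reindex_onto (glue r)
    (fun a : {ffun 'I_k -> bits n} => [ffun j => a j i0])) /=; last first.
    move=> a /andP[_ /eqP ar]; apply/ffunP => j; apply/ffunP => i.
    by rewrite !ffunE; case: eqVneq => [->//|ii0]; rewrite -ar keyin.
  pose f j b y := B j (upd i0 (r j) b) (upd i0 (z t r j) y).
  have fP j y : \sum_b f j b y = \sum_b f j b false.
    have := @box_nonsignaling R n (B j) (~: [set i0])%SET (r j)
      (upd i0 (z t r j) y) (upd i0 (z t r j) false).
    have ag x b b' : agree_on (~: [set i0])%SET (upd i0 x b) (upd i0 x b').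
      by apply/forallP => i; rewrite !inE !ffunE; case: (i == i0); rewrite /= ?eqxx.
    move=> /(_ (ag _ _ _)).
    have reidx (G : bits n -> R) :
        \sum_(a' | agree_on (~: [set i0])%SET a' (r j)) G a' =
        \sum_b G (upd i0 (r j) b).
      rewrite (reindex_onto (upd i0 (r j)) (fun a : bits n => a i0)) /=.
        apply: eq_bigl => b; rewrite [upd _ _ _ i0]ffunE !eqxx andbT.
        by apply/forallP => i; rewrite !inE !ffunE; case: (i == i0); rewrite /= ?eqxx.
      move=> a /forallP aP; apply/ffunP => i; rewrite ffunE.
      case: eqVneq => [->//|ii0].
      by have := aP i; rewrite !inE ii0 /= => /eqP.
    by rewrite !reidx.
  rewrite -(sum_strategy (t i0) fP); apply: eq_big => o.
    rewrite (agE _ r) ?rS /=; last by move=> i j /negbTE ii0; rewrite !ffunE ii0.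
    apply/andP; split; apply/eqP.
      rewrite -[RHS]rK; apply/ffunP => j; apply/ffunP => i; rewrite !ffunE.
      by case: eqP.
    by apply/ffunP => j; rewrite !ffunE eqxx.
  move=> _; apply: eq_bigr => j _; rewrite /f ffunE; congr (B j _ _).
  apply/ffunP => i; rewrite !ffunE; case: eqVneq => [->|ii0].
    by apply: eq_query_input => j'; rewrite !ffunE eqxx.
  by apply: eq_query_input => j'; rewrite !ffunE (negbTE ii0).
rewrite !margE; apply: eq_big => r.
  congr (_ && _); apply: eq_forallb => i; case: (boolP (i \in S)) => //= iS.
  by rewrite !ffunE ss' //; apply: contraNneq i0S => <-.
move=> _; apply: eq_bigr => j _; apply: eq_bigr => b _; congr (B j _ _).
by apply/ffunP => i; rewrite !ffunE; case: eqVneq => // ii0; rewrite ss'.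
Qed.

Lemma eq_marg B s s' S c : s =1 s' -> marg B s S c = marg B s' S c.
Proof. by move=> /funext ->. Qed.

Lemma marg_strategies B s s' S c :
  {in S, s =1 s'} -> marg B s S c = marg B s' S c.
Proof.
move=> ss'; pose h m (i : 'I_n) := if (i < m)%N then s' i else s i.
have hm m : (m <= n)%N -> marg B s S c = marg B (h m) S c.
  elim: m => [_|m IH mn]; first exact: eq_marg.
  rewrite IH ?(ltnW mn) //; pose i0 := Ordinal mn.
  have hE i : i != i0 -> h m i = h m.+1 i.
    move=> ii0; rewrite /h ltnS [in RHS]leq_eqVlt.
    have -> : (nat_of_ord i == m) = false by apply/negbTE.
    by [].
  have [i0S|i0S] := boolP (i0 \in S); last exact: marg_local hE.
  apply: eq_marg => i; have [->|] := eqVneq i i0; last exact: hE.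
  by rewrite /h /= ltnn ltnSn ss'.
rewrite (hm n) //; apply: eq_marg => i.
by rewrite /h ltn_ord.
Qed.

Lemma sum_wiring B s S c :
  \sum_(c' | agree_on S c' c) wiring_prob B s c' = marg B s S c.
Proof.
rewrite /marg (partition_big (final_outputs s) (fun c' => agree_on S c' c)) //=.
apply: eq_bigr => c' c'S; apply: eq_bigl => a.
by case: eqP => [->|]; rewrite ?c'S ?andbF.
Qed.

Lemma wiring_ge0 B s c : 0 <= wiring_prob B s c.
Proof.
by apply: sumr_ge0 => a _; apply: prodr_ge0 => j _; apply: box_ge0.
Qed.

Lemma wiring_sum1 B s : \sum_c wiring_prob B s c = 1.
Proof.
pose c0 : bits n := [ffun=> false].
have ag c : agree_on finset.set0 c c0 by apply/forallP => i; rewrite inE.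
rewrite -(eq_bigl _ _ ag) sum_wiring.
rewrite (@marg_strategies _ _ (fun=> Output _ false)); last by move=> i; rewrite inE.
rewrite /marg (eq_bigl predT); last by move=> a; apply: ag.
rewrite (eq_bigr (fun a : {ffun 'I_k -> bits n} => \prod_j B j (a j) c0)).
  by rewrite -(bigA_distr_bigA (fun j b => B j b c0)) big1 // => j _; rewrite box_sum1.
move=> a _; apply: eq_bigr => j _; congr (B j _ _).
Qed.

Lemma run_prob_ge0 pi B c x : 0 <= run_prob pi B c x.
Proof.
by apply: sumr_ge0 => l _; rewrite mulr_ge0 ?rand_prob_ge0 ?wiring_ge0.
Qed.

Lemma run_prob_sum1 pi B x : \sum_c run_prob pi B c x = 1.
Proof.
rewrite exchange_big /= -[RHS](rand_prob_sum1 pi); apply: eq_bigr => l _.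
by rewrite -mulr_sumr wiring_sum1 mulr1.
Qed.

Lemma run_prob_nonsignaling pi B S c x x' : agree_on S x x' ->
  \sum_(c' | agree_on S c' c) run_prob pi B c' x =
  \sum_(c' | agree_on S c' c) run_prob pi B c' x'.
Proof.
move=> xx'; rewrite exchange_big /= [RHS]exchange_big /=.
apply: eq_bigr => l _; rewrite -!mulr_sumr !sum_wiring; congr (_ * _).
apply: marg_strategies => i iS.
by move/forallP: xx' => /(_ i); rewrite iS => /eqP ->.
Qed.

Definition run pi B : box R n :=
  Box (run_prob_ge0 pi B) (run_prob_sum1 pi B) (@run_prob_nonsignaling pi B).

Definition simulates B (B' : box R n) : Prop :=
  exists pi : protocol R n k, forall c x, run pi B c x = B' c x.

End Run.

Definition copies (R : realType) n k (B : box R n) : 'I_k -> box R n :=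
  fun=> B.
Arguments copies {R n} k B _.

Definition tv_dist (R : realType) n (B B' : box R n) (x : bits n) : R :=
  2^-1 * \sum_a `|B a x - B' a x|.

(* Closeness of boxes is total variation distance, uniformly in the inputs; all
   distances on the finite-dimensional space of boxes are equivalent. *)
Definition asymptotically_simulates (R : realType) n (B B' : box R n) : Prop :=
  forall delta : R, 0 < delta ->
    exists (k : nat) (pi : protocol R n k),
      forall x, tv_dist (run pi (copies k B)) B' x < delta.

Section BS.
Variables (R : realType) (n : nat).

Definition bs_strategy (x : bool) : strategy 2 :=
  Query ord0 x (fun a =>
  Query ord_max (x && (true (+) a)) (fun b =>
  Output 2 (a (+) b))).

Lemma unit_prob_sum1 : \sum_(l : unit) 1 = 1 :> R.
Proof. by rewrite big_const card_unit /= addr0. Qed.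

Definition bs_protocol : protocol R n 2 :=
  @Protocol R n 2 unit (fun=> 1) (fun=> ler01) unit_prob_sum1
    (fun _ _ x => bs_strategy x).

Definition bs_box (B : box R n) : box R n := run bs_protocol (copies 2 B).

(* Each round turns two independent copies of a box into one copy of a new box,
   so m rounds consume 2 ^ m copies of B. *)
Definition bs_iter (m : nat) (B : box R n) : box R n := iter m bs_box B.

End BS.

(* Main.v *)
Require Import Defs.
From HB Require Import structures.
From mathcomp Require Import all_boot all_order all_algebra.
From mathcomp Require Import all_classical all_reals all_analysis.
From mathcomp Require Import ring.
Import Order.TTheory GRing.Theory Num.Theory numFieldNormedType.Exports.
Local Open Scope classical_set_scope.
Local Open Scope ring_scope.

(* On an input other than all ones, both boxes of the protocol have even parity
   and so does the output. On the all-ones input, the second box is queried on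
   all ones only if the first box answers a = 0, an even answer of probability
   (1 - e) w with w = 2^-(n-1); so the output has odd parity with probability
   e' = e + w e (1 - e), and it is uniform given its parity. Since
   1 - e' = (1 - e) (1 - w e), the iterates of e tend to 1 geometrically. *)

(** * Bit strings: outputs of the protocol and inputs to the second box *)

Definition xorf {n : nat} (a b : bits n) : bits n := [ffun i => a i (+) b i].

(** What the parties input to the second box when the first one, on input [x], answers [a]. *)
Definition bs_input {n : nat} (x a : bits n) : bits n :=
  [ffun i => x i && ~~ a i].

Lemma parity_xorf n (a b : bits n) : parity (xorf a b) = parity a (+) parity b.
Proof.
by rewrite /parity -big_split; apply: eq_bigr => i _; rewrite ffunE.
Qed.

Lemma xorf_eq n (a b c : bits n) : (xorf a b == c) = (b == xorf a c).
Proof.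
by apply/eqP/eqP => [<-|->]; apply/ffunP => i; rewrite !ffunE addbA addbb.
Qed.

(** * Sequential composition of strategies *)

(** A monadic bind: [s] runs on boxes renamed along [f], and [g] continues from its output, possibly
    on other boxes. *)
Fixpoint substitute {k l : nat} (f : 'I_k -> 'I_l) (g : bool -> strategy l)
    (s : strategy k) : strategy l :=
  match s with
  | Output c => g c
  | Query j y next => Query (f j) y (fun b => substitute f g (next b))
  end.

Lemma final_output_substitute k l (f : 'I_k -> 'I_l) g s o :
  final_output (substitute f g s) o =
  final_output (g (final_output s (o \o f))) o.
Proof. by elim: s => //= j y next IH; rewrite IH. Qed.

(** The hypothesis on [g] matches the default input 0 that [query_input] assigns to a box which [s]
    leaves unqueried. *)
Lemma query_input_substitute_in k l (f : 'I_k -> 'I_l) g s o j :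
  injective f -> (forall c, query_input (g c) o (f j) = false) ->
  query_input (substitute f g s) o (f j) = query_input s (o \o f) j.
Proof.
move=> f_inj gP; elim: s => [c|j0 y next IH] /=; first exact: gP.
by rewrite (inj_eq f_inj) IH.
Qed.

(** All queries of [s] go to the image of [f], so the continuation alone decides the input of
    [j]. *)
Lemma query_input_substitute_out k l (f : 'I_k -> 'I_l) g s o j :
  (forall i, j != f i) ->
  query_input (substitute f g s) o j =
  query_input (g (final_output s (o \o f))) o j.
Proof.
by move=> jf; elim: s => //= j0 y next IH; rewrite (negbTE (jf _)) IH.
Qed.

(** One round in which each of the two boxes is itself simulated by [s], the first on the left block
    of k copies, the second on the right block. Nesting this turns m rounds into a single
    strategy. *)
Definition bs_compose {k : nat} (s : bool -> strategy k) (x : bool) :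
    strategy (k + k) :=
  substitute (lshift k)
    (fun a => substitute (@rshift k k) (fun b => Output (k + k) (a (+) b))
                (s (x && ~~ a)))
    (s x).

Section BsCompose.
Variables (R : realType) (n k : nat) (B : box R n) (s : bool -> strategy k).
Implicit Types (a c x : bits n) (A : {ffun 'I_k -> bits n}).

Let join A1 A2 : {ffun 'I_(k + k) -> bits n} :=
  [ffun j : 'I_(k + k) =>
     match fintype.split j with inl i => A1 i | inr i => A2 i end].

Let joinl A1 A2 j : join A1 A2 (lshift k j) = A1 j.
Proof. by rewrite ffunE -[lshift _ _]/(unsplit (inl j)) unsplitK. Qed.

Let joinr A1 A2 j : join A1 A2 (rshift k j) = A2 j.
Proof. by rewrite ffunE -[rshift _ _]/(unsplit (inr j)) unsplitK. Qed.

Let W x c : R := wiring_prob (copies k B) (fun i => s (x i)) c.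

Let weight x A : R := \prod_j B (A j) (box_inputs (fun i => s (x i)) A j).

Let outs x A : bits n := final_outputs (fun i => s (x i)) A.

Let join_outl x A1 A2 i :
  final_output (s (x i)) ((fun j => join A1 A2 j i) \o lshift k) = outs x A1 i.
Proof.
by rewrite ffunE; apply: eq_final_output => j /=; rewrite joinl.
Qed.

Let outs_join x A1 A2 :
  final_outputs (fun i => bs_compose s (x i)) (join A1 A2) =
  xorf (outs x A1) (outs (bs_input x (outs x A1)) A2).
Proof.
apply/ffunP => i; rewrite ffunE /bs_compose !final_output_substitute /=.
rewrite join_outl [RHS]ffunE; congr (_ (+) _); rewrite [RHS]ffunE [in RHS]ffunE.
by apply: eq_final_output => j /=; rewrite joinr.
Qed.

Let inputs_joinl x A1 A2 j :
  box_inputs (fun i => bs_compose s (x i)) (join A1 A2) (lshift k j) =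
  box_inputs (fun i => s (x i)) A1 j.
Proof.
apply/ffunP => i; rewrite !ffunE query_input_substitute_in.
- by apply: eq_query_input => j' /=; rewrite joinl.
- exact: lshift_inj.
move=> c; rewrite query_input_substitute_out // => j'.
by rewrite eq_lrshift.
Qed.

Let inputs_joinr x A1 A2 j :
  box_inputs (fun i => bs_compose s (x i)) (join A1 A2) (rshift k j) =
  box_inputs (fun i => s (bs_input x (outs x A1) i)) A2 j.
Proof.
apply/ffunP => i; rewrite 2!ffunE query_input_substitute_out; last first.
  by move=> j'; rewrite eq_rlshift.
rewrite join_outl query_input_substitute_in //; last exact: rshift_inj.
by rewrite [in RHS]ffunE; apply: eq_query_input => j' /=; rewrite joinr.
Qed.

(** The blocks are independent once the output [a] of the first is fixed; the total output is [c]
    exactly when the second block outputs [xorf a c]. *)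
Lemma wiring_bs_compose c x :
  wiring_prob (copies (k + k) B) (fun i => bs_compose s (x i)) c =
  \sum_a W x a * W (bs_input x a) (xorf a c).
Proof.
(* An outcome of the 2k boxes is a pair of outcomes, one for each block. *)
rewrite {1}/wiring_prob (reindex
    (fun p : {ffun 'I_k -> bits n} * {ffun 'I_k -> bits n} => join p.1 p.2)) /=;
  last first.
  exists (fun A : {ffun 'I_(k + k) -> bits n} =>
      ([ffun j => A (lshift k j)], [ffun j => A (rshift k j)])).
    by move=> [A1 A2] _; congr (_, _); apply/ffunP => j;
       rewrite ffunE ?joinl ?joinr.
  move=> A _; apply/ffunP => j; rewrite ffunE.
  by case: splitP => i ij; rewrite ffunE; congr (A _); apply/val_inj.
rewrite (eq_bigl (fun p => true && (outs (bs_input x (outs x p.1)) p.2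
                               == xorf (outs x p.1) c))); last first.
  by move=> [A1 A2] /=; rewrite outs_join xorf_eq.
rewrite (eq_bigr (fun p => weight x p.1 *
    weight (bs_input x (outs x p.1)) p.2)); last first.
  move=> [A1 A2] _ /=; rewrite big_split_ord /=; congr (_ * _);
    by apply: eq_bigr => j _; rewrite /copies ?joinl ?joinr
      ?inputs_joinl ?inputs_joinr.
rewrite -(pair_big_dep predT
  (fun A1 A2 => outs (bs_input x (outs x A1)) A2 == xorf (outs x A1) c)
  (fun A1 A2 => weight x A1 * weight (bs_input x (outs x A1)) A2)) /=.
(* Group the outcomes of the first block by the string [a] that they make the parties output. *)
rewrite (partition_big (outs x) predT) //=; apply: eq_bigr => a _.
rewrite {1}/W /wiring_prob mulr_suml; apply: eq_bigr => A1 /eqP A1a.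
by rewrite A1a -mulr_sumr.
Qed.

End BsCompose.

(** * Rounds of the protocol as deterministic wirings *)

Definition single_query (x : bool) : strategy 1 := Query ord0 x (@Output 1).

Lemma wiring_single_query (R : realType) n (B : box R n) (c x : bits n) :
  wiring_prob (copies 1 B) (fun i => single_query (x i)) c = B c x.
Proof.
rewrite /wiring_prob (big_pred1 [ffun=> c]) => [|A].
  by rewrite big_ord1 ffunE; congr (B c _); apply/ffunP => i; rewrite ffunE.
apply/eqP/eqP => [<-|->]; apply/ffunP => i; rewrite !ffunE /=.
  by apply/ffunP => j; rewrite ffunE (ord1 i).
by rewrite ffunE.
Qed.

Lemma bs_strategyE x : bs_strategy x = bs_compose single_query x.
Proof.
rewrite /bs_strategy /bs_compose /=.
have -> : @lshift 1 1 ord0 = ord0 :> 'I_2 by exact: val_inj.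
by have -> : @rshift 1 1 ord0 = ord_max :> 'I_2 by exact: val_inj.
Qed.

Definition deterministic {R : realType} {n k : nat} (s : bool -> strategy k) :
    protocol R n k :=
  @Protocol R n k unit (fun=> 1) (fun=> ler01) (unit_prob_sum1 R)
    (fun _ _ => s).

Lemma run_deterministic (R : realType) n k (B : 'I_k -> box R n) s c x :
  run (deterministic s) B c x = wiring_prob B (fun i => s (x i)) c.
Proof. by rewrite /= /run_prob /= big_const card_unit /= addr0 mul1r. Qed.

Lemma bs_boxE (R : realType) n (B : box R n) c x :
  bs_box B c x = \sum_a B a x * B (xorf a c) (bs_input x a).
Proof.
rewrite -[LHS]/(run (deterministic bs_strategy) _ c x) run_deterministic.
rewrite (_ : (fun i => _) = fun i => bs_compose single_query (x i)).
  rewrite (@wiring_bs_compose _ _ 1); apply: eq_bigr => a _.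
  by rewrite !wiring_single_query.
by apply/funext => i; exact: bs_strategyE.
Qed.

(** Stated for one deterministic strategy common to all parties, the form that [bs_compose] takes,
    so that the induction on rounds goes through. *)
Lemma bs_iter_wiring {R : realType} {n} (B : box R n) m :
  exists s : bool -> strategy (2 ^ m),
    forall c x : bits n, wiring_prob (copies (2 ^ m) B) (fun i => s (x i)) c =
                bs_iter m B c x.
Proof.
elim: m => [|m [s IH]].
  by exists single_query => c x; rewrite wiring_single_query.
rewrite expnS mul2n -addnn; exists (bs_compose s) => c x.
rewrite wiring_bs_compose [RHS]bs_boxE.
by apply: eq_bigr => a _; rewrite !IH.
Qed.

Lemma bs_iter_simulated {R : realType} {n} (B : box R n) m :
  simulates (copies (2 ^ m) B) (bs_iter m B).
Proof.
have [s sP] := bs_iter_wiring B m.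
by exists (deterministic s) => c x; rewrite run_deterministic.
Qed.

(** * One round on correlated non-local boxes *)

Section Correlated.
Variables (R : realType) (n : nat) (n_gt0 : (0 < n)%N).
Implicit Types (e : {i01 R}) (a c x : bits n).

Let w : R := 2 ^- n.-1.

Lemma weight_gt0 : 0 < w. Proof. by rewrite invr_gt0 exprn_gt0. Qed.

Lemma weight_le1 : w <= 1.
Proof. by rewrite invf_le1 ?exprn_gt0 // exprn_ege1 // ler1n. Qed.

(** The n-PR and even-parity boxes differ only on the all-ones input, where odd outputs have total
    weight e. *)
Lemma cnl_boxE e a x :
  cnl_box n_gt0 e a x =
  w * (if \big[andb/true]_i x i then if parity a then e%:num else 1 - e%:num
       else (~~ parity a)%:R).
Proof.
rewrite /= /cnl_prob /= /pr_prob /even_prob -/w.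
by case: (\big[andb/true]_i x i); case: (parity a) => /=; ring.
Qed.

Lemma bs_input_all x a :
  \big[andb/true]_i bs_input x a i =
  (\big[andb/true]_i x i) && (a == [ffun=> false]).
Proof.
rewrite (eq_bigr (fun i => x i && ~~ a i)) => [|i _]; last by rewrite ffunE.
rewrite big_split /=; congr (_ && _); rewrite big_andE.
apply/forallP/eqP => [aP|-> i]; last by rewrite ffunE.
by apply/ffunP => i; rewrite ffunE; apply/negbTE/aP.
Qed.

Lemma sum_parity (b : bool) : \sum_(a : bits n) w * (parity a == b)%:R = 1.
Proof.
rewrite -[RHS](parity_prob_sum1 R b n_gt0); apply: eq_bigr => a _.
by case: eqP; rewrite ?mulr1 ?mulr0.
Qed.

Definition bs_param (t : R) : R := t + w * t * (1 - t).

Lemma bs_param_compl t : 1 - bs_param t = (1 - t) * (1 - w * t).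
Proof. by rewrite /bs_param; ring. Qed.

Lemma bs_param_ge0 e : 0 <= bs_param e%:num.
Proof.
by rewrite addr_ge0 // mulr_ge0 ?subr_ge0 // mulr_ge0 // ltW ?weight_gt0.
Qed.

Lemma bs_param_le1 e : bs_param e%:num <= 1.
Proof.
rewrite -subr_ge0 bs_param_compl mulr_ge0 ?subr_ge0 //.
by rewrite mulr_ile1 // ?weight_le1 // ltW ?weight_gt0.
Qed.

Definition bs_i01 e : {i01 R} := Itv01 (bs_param_ge0 e) (bs_param_le1 e).

Lemma bs_i01E e : (bs_i01 e)%:num = bs_param e%:num.
Proof. by []. Qed.

Lemma bs_cnl_box e c x :
  bs_box (cnl_box n_gt0 e) c x = cnl_box n_gt0 (bs_i01 e) c x.
Proof.
rewrite bs_boxE cnl_boxE bs_i01E.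
under [LHS]eq_bigr do rewrite !cnl_boxE parity_xorf bs_input_all.
case: (\big[andb/true]_i x i) => /=; last first.
  (* Multiply the right side by 1, written as the total weight of the even strings [a]; the two sums
     then agree term by term. *)
  rewrite -[RHS]mul1r -[X in _ = X * _](sum_parity false) mulr_suml.
  apply: eq_bigr => a _.
  by case: (parity a); rewrite /= ?(mulr0, mul0r).
(* The first summand is what a second box of even parity would contribute; the
   second one corrects the term a = 0. *)
pose a0 : bits n := [ffun=> false].
have par0 : parity a0 = false by rewrite /parity big1 // => i _; rewrite ffunE.
(* [q b] is the probability that the correlated box outputs parity [b] on the all-ones input. *)
pose q (b : bool) : R := if b then e%:num else 1 - e%:num.
transitivity (\sum_a (w * (parity a == parity c)%:R * (w * q (parity c)) +
   if a == a0 then w * (1 - e%:num) * (w * (q (parity c) - (~~ parity c)%:R))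
   else 0)).
  apply: eq_bigr => a _; case: eqVneq => [->|_]; rewrite ?par0 /q.
    by case: (parity c) => /=; ring.
  by case: (parity a); case: (parity c) => /=; ring.
rewrite big_split /= -mulr_suml sum_parity -big_mkcond big_pred1_eq.
rewrite /q /bs_param.
by case: (parity c) => /=; ring.
Qed.

Lemma bs_iter_cnl_box e m c x :
  bs_iter m (cnl_box n_gt0 e) c x = cnl_box n_gt0 (iter m bs_i01 e) c x.
Proof.
(* The induction hypothesis equates boxes only pointwise, so it is applied inside the sum describing
   one round. *)
elim: m c x => // m IH c x; rewrite -[RHS]bs_cnl_box [LHS]bs_boxE [RHS]bs_boxE.
by apply: eq_bigr => a _; rewrite !IH.
Qed.

(** * Growth and convergence of the parameter *)

Lemma bs_i01_ge e : e%:num <= (bs_i01 e)%:num.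
Proof.
by rewrite bs_i01E lerDl mulr_ge0 ?subr_ge0 // mulr_ge0 // ltW ?weight_gt0.
Qed.

Lemma bs_i01_gt e : 0 < e%:num < 1 -> e%:num < (bs_i01 e)%:num.
Proof.
by case/andP=> e0 e1; rewrite bs_i01E ltrDl !mulr_gt0 ?subr_gt0 // weight_gt0.
Qed.

(** Round j multiplies the complement by 1 - w e_j, at most 1 - w e because the parameters e_j never
    fall below e. *)
Lemma bs_i01_iter_compl e m :
  1 - (iter m bs_i01 e)%:num <= (1 - w * e%:num) ^+ m.
Proof.
have iter_ge j : e%:num <= (iter j bs_i01 e)%:num.
  by elim: j => // j IH; apply: le_trans IH (bs_i01_ge _).
elim: m => [|m IH]; first by rewrite expr0 lerBlDr lerDl.
rewrite iterS bs_i01E bs_param_compl exprSr ler_pM ?subr_ge0 //.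
  by rewrite mulr_ile1 // ?weight_le1 // ltW ?weight_gt0.
by rewrite lerB // ler_wpM2l // ltW ?weight_gt0.
Qed.

Lemma bs_i01_iter_cvg e : 0 < e%:num ->
  (fun m => 1 - (iter m bs_i01 e)%:num) @ \oo --> (0 : R).
Proof.
move=> e0.
apply: (@squeeze_cvgr _ _ _ _ (fun=> 0) (fun m => (1 - w * e%:num) ^+ m)).
- by near=> m; rewrite bs_i01_iter_compl subr_ge0 andbT.
- exact: cvg_cst.
apply: cvg_expr; rewrite ger0_norm ?subr_ge0.
  by rewrite ltrBlDr ltrDl mulr_gt0 ?weight_gt0.
by rewrite mulr_ile1 // ?weight_le1 // ltW ?weight_gt0.
Unshelve. all: by end_near.
Qed.

(** * Distance to the n-PR box *)

Lemma cnl_boxB e c x :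
  cnl_box n_gt0 e c x - pr_box R n_gt0 c x =
  (1 - e%:num) * (even_box R n_gt0 c x - pr_box R n_gt0 c x).
Proof. by rewrite /= /cnl_prob /=; ring. Qed.

(** The absolute difference of the even-parity and n-PR boxes is at most their sum, of total mass 2,
    which cancels the factor 1/2. *)
Lemma tv_dist_cnl_pr e x :
  tv_dist (cnl_box n_gt0 e) (pr_box R n_gt0) x <= 1 - e%:num.
Proof.
have e1 : 0 <= 1 - e%:num by rewrite subr_ge0.
rewrite /tv_dist ler_pdivrMl //.
apply: (@le_trans _ _ (\sum_a (1 - e%:num) *
    (even_box R n_gt0 a x + pr_box R n_gt0 a x))).
  apply: ler_sum => a _; rewrite cnl_boxB normrM ger0_norm // ler_wpM2l //.
  by apply: le_trans (ler_normB _ _) _; rewrite !ger0_norm ?box_ge0.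
rewrite -mulr_sumr big_split /= (box_sum1 (even_box R n_gt0)).
by rewrite (box_sum1 (pr_box R n_gt0)) mulrC.
Qed.

End Correlated.

Theorem theorem1 (R : realType) (n : nat) (n_gt0 : (0 < n)%N) :
  (forall e : {i01 R}, 0 < e%:num < 1 ->
    exists e' : {i01 R},
      [/\ e%:num < e'%:num,
          forall c x, bs_box (cnl_box n_gt0 e) c x = cnl_box n_gt0 e' c x
        & simulates (copies 2 (cnl_box n_gt0 e)) (cnl_box n_gt0 e')])
  /\
  (forall e : {i01 R}, 0 < e%:num ->
    (forall c x,
      (fun m => bs_iter m (cnl_box n_gt0 e) c x) @ \oo --> pr_box R n_gt0 c x)
    /\ asymptotically_simulates (cnl_box n_gt0 e) (pr_box R n_gt0)).
Proof.
split=> e e0.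
  exists (bs_i01 R n e); split; [exact: bs_i01_gt|exact: bs_cnl_box|].
  by exists (bs_protocol R n) => c x; rewrite -[LHS]/(bs_box _ c x) bs_cnl_box.
have cvg0 := bs_i01_iter_cvg R n e e0; split=> [c x|delta delta_gt0].
  (* Each iterate is the n-PR box plus a fixed difference scaled by a coefficient that tends to
     0. *)
  rewrite (_ : (fun m => _) = fun m => pr_box R n_gt0 c x +
      (1 - (iter m (bs_i01 R n) e)%:num) *
      (even_box R n_gt0 c x - pr_box R n_gt0 c x)); last first.
    by apply/funext => m; rewrite bs_iter_cnl_box -cnl_boxB addrC subrK.
  rewrite -[X in _ --> X]addr0; apply: cvgD; first exact: cvg_cst.
  by rewrite -[X in _ --> X](mul0r (even_box R n_gt0 c x - pr_box R n_gt0 c x));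
     apply: cvgMl.
(* Take enough rounds for the complement of the parameter, which bounds the distance for every
   input, to drop below [delta]. *)
have [m _ /(_ m (leqnn m)) /= m_delta] := cvgr_lt 0 cvg0 _ delta_gt0.
have [pi piP] := bs_iter_simulated (cnl_box n_gt0 e) m.
exists (2 ^ m)%N, pi => x; apply: le_lt_trans m_delta.
apply: le_trans (tv_dist_cnl_pr R n n_gt0 _ x).
rewrite le_eqVlt; apply/orP; left; apply/eqP; congr (_ * _); apply: eq_bigr => a _.
by rewrite piP bs_iter_cnl_box.
Qed.
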